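(* Let $\mathcal{F}=((X,d),(f_i)_{i\in I})$ be a generalized possibly infinite iterated function system of order $m\in\mathbb{N}^*$ such that the family of functions $(f_i)_{i\in I}$ is uniformly equicontinuous, i.e. for each $\varepsilon>0$ there exists $\delta_\varepsilon>0$ such that for every $i\in I$ and every $x,y\in X^m$ with $d_{\max}(x,y)<\delta_\varepsilon$ we have $d(f_i(x),f_i(y))<\varepsilon$. Then the operator $H_{\mathcal{F}}:\mathcal{C}^m\to\mathcal{C}$ is continuous.
   Context: $\mathbb{N}^{*}=\{1,2,\dots\}$. The sets $X$ and $I$ are nonempty. For a metric space $(Y,\rho)$ and $m\in\mathbb{N}^*$, $Y^m$ carries the maximum metric $\rho_{\max}((x_1,\dots,x_m),(y_1,\dots,y_m))=\max_j \rho(x_j,y_j)$; for $(X,d)$ it is written $d_{\max}$. A generalized possibly infinite iterated function system of order $m$ is a pair $\mathcal{F}=((X,d),(f_i)_{i\in I})$, where $(X,d)$ is a metric space, each $f_i:X^m\to X$ is continuous, and the family $(f_i)_{i\in I}$ is bounded, i.e. $\bigcup_{i\in I}f_i(B)$ is bounded for every bounded $B\subseteq X^m$. Code space: $\Omega_1=I$, $\Omega_{k+1}=\Omega_k\times\dots\times\Omega_k$ ($m$ times), and $\Omega=\Omega_1\times\Omega_2\times\cdots$. Elements of $\Omega$ are written $\alpha=\alpha^1\alpha^2\dots\alpha^k\dots$ with $\alpha^k\in\Omega_k$; for $k\ge2$ write $\alpha^k=\alpha^k_1\alpha^k_2\dots\alpha^k_m$ with $\alpha^k_i\in\Omega_{k-1}$,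 and for $i\in\{1,\dots,m\}$ put $\alpha(i)=\alpha^2_i\alpha^3_i\alpha^4_i\dots\in\Omega$. $\Omega$ is endowed with the metric $d(\alpha,\beta)=\sum_{k\ge1}c^k\,\delta(\alpha^k,\beta^k)$, where $c\in(0,1)$ is fixed and $\delta(\alpha^k,\beta^k)$ is $1$ if $\alpha^k\neq\beta^k$ and $0$ otherwise. $\mathcal{C}$ is the set of continuous bounded functions $f:\Omega\to X$ with the metric $d_u(f,g)=\sup_{\alpha\in\Omega}d(f(\alpha),g(\alpha))$; $\mathcal{C}^m$ carries the corresponding maximum metric. The operator $H_{\mathcal{F}}:\mathcal{C}^m\to\mathcal{C}$ is $H_{\mathcal{F}}(g_1,\dots,g_m)(\alpha)=f_{\alpha^1}(g_1(\alpha(1)),\dots,g_m(\alpha(m)))$ for $\alpha=\alpha^1\alpha^2\dots\in\Omega$. *)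

(* Defs.v *)
From HB Require Import structures.
From mathcomp Require Import all_boot all_order all_algebra.
From mathcomp Require Import all_classical all_reals all_analysis.
Set Implicit Arguments.
Unset Strict Implicit.
Unset Printing Implicit Defensive.
Import Order.TTheory GRing.Theory Num.Theory.
Import numFieldTopology.Exports.
Local Open Scope classical_set_scope.
Local Open Scope ring_scope.

Definition metric_bounded (R : realType) (M : metricType R) (A : set M) :=
  exists K : R, forall x y, A x -> A y -> mdist x y <= K.

Section max_metric.
Context {R : realType} {X : metricType R} {m : nat}.
Implicit Types x y : 'rV[X]_m.

(* Distances are nonnegative, so 0 is neutral for the maximum. *)
Definition rv_mdist x y : R := \big[Num.max/0]_(j < m) mdist (x 0 j) (y 0 j).

Let rv_mdist_ge0 x y : 0 <= rv_mdist x y.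
Proof. exact: bigmax_ge_id. Qed.

Let rv_mdist_positivity x y : rv_mdist x y = 0 -> x = y.
Proof.
move=> xy0; apply/rowP => j; apply: mdist_positivity.
apply/eqP; rewrite eq_le mdist_ge0 andbT -xy0.
exact: (le_bigmax_cond 0 (fun j => mdist (x 0 j) (y 0 j))).
Qed.

Let rv_ballEmdist x d : ball x d = [set y | rv_mdist x y < d].
Proof.
apply/seteqP; split => y /=.
  case=> d0 xyd; apply/bigmax_ltP; split=> // j _.
  by have := xyd 0 j; rewrite ballEmdist.
move=> /bigmax_ltP[d0 xyd]; split=> // i j.
by rewrite ballEmdist/= (ord1 i); exact: xyd.
Qed.

(* The pseudometric (hence the topology) on 'rV[X]_m is the library's one. *)
HB.instance Definition _ := PseudoMetric_isMetric.Build R 'rV[X]_m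
  rv_mdist_ge0 rv_mdist_positivity rv_ballEmdist.

End max_metric.

Record gifs (R : realType) (X : metricType R) (I : Type) (m : nat) := Gifs {
  gifs_fun :> I -> 'rV[X]_m -> X;
  gifs_continuous : forall i, continuous (gifs_fun i);
  gifs_bounded : forall B : set 'rV[X]_m, metric_bounded B ->
    metric_bounded (\bigcup_(i in [set: I]) (gifs_fun i @` B)) }.

Definition uniformly_equicontinuous (R : realType) (I : Type)
    (M N : metricType R) (f : I -> M -> N) :=
  forall eps : R, 0 < eps -> exists2 delta : R, 0 < delta &
    forall i x y, mdist x y < delta -> mdist (f i x) (f i y) < eps.

(* Levels are numbered from 0: [code_level I m k] is $\Omega_{k+1}$, and [a k]
   is $\alpha^{k+1}$. *)
Fixpoint code_level (I : Type) (m k : nat) : Type :=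
  if k is k'.+1 then 'rV[code_level I m k']_m else I.

(* The metric depends on [c], which therefore is a parameter of the type. *)
Definition code_space (R : realType) (I : Type) (m : nat)
    (c : {itv R & `]0, 1[}) :=
  forall k, code_level I m k.

Section code_metric.
Context {R : realType} {I : Type} {m : nat} {c : {itv R & `]0, 1[}}.
Local Notation code_space := (@code_space R I m c).
Implicit Types a b : code_space.

HB.instance Definition _ := gen_eqMixin code_space.
HB.instance Definition _ := gen_choiceMixin code_space.

Definition code_delta a b k : R := (~~ `[< a k = b k >])%:R.

Definition code_mdist a b : R :=
  limn (series (fun k => c%:num ^+ k.+1 * code_delta a b k)).

Let c_gt0 : 0 < c%:num. Proof. by []. Qed.
Let c_lt1 : c%:num < 1. Proof. by []. Qed.

Let term_ge0 a b k : 0 <= c%:num ^+ k.+1 * code_delta a b k.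
Proof. by rewrite mulr_ge0 ?exprn_ge0 ?ler0n// ltW. Qed.

Lemma is_cvg_code_mdist a b :
  cvgn (series (fun k => c%:num ^+ k.+1 * code_delta a b k)).
Proof.
apply: (@series_le_cvg _ _ (geometric c%:num c%:num)) => //.
- by move=> k; rewrite /= mulr_ge0 ?exprn_ge0// ltW.
- move=> k; rewrite /= -exprS ler_piMr ?exprn_ge0// ?(ltW c_gt0)//.
  by rewrite /code_delta lern1 leq_b1.
- by apply: is_cvg_geometric_series; rewrite ger0_norm// ltW.
Qed.

Lemma code_mdist_ge_term a b k :
  c%:num ^+ k.+1 * code_delta a b k <= code_mdist a b.
Proof.
apply: (@le_trans _ _
  (series (fun k => c%:num ^+ k.+1 * code_delta a b k) k.+1)).
  by rewrite /series/= big_nat_recr//= lerDr sumr_ge0.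
apply: nondecreasing_cvgn_le; last exact: is_cvg_code_mdist.
by apply: nondecreasing_series => *; exact: term_ge0.
Qed.

Lemma code_mdist_eq a b k : code_mdist a b < c%:num ^+ k.+1 -> a k = b k.
Proof.
move=> abk; have := le_lt_trans (code_mdist_ge_term a b k) abk.
rewrite /code_delta; case: asboolP => //= _; by rewrite mulr1 ltxx.
Qed.

Let code_mdistxx a : code_mdist a a = 0.
Proof.
rewrite /code_mdist [series _](_ : _ = fun=> 0) ?lim_cst//.
apply/funext => n; rewrite /series/= big1// => k _.
by rewrite /code_delta; case: asboolP => //= _; rewrite mulr0.
Qed.

Let code_mdist_positivity a b : code_mdist a b = 0 -> a = b.
Proof.
by move=> ab0; apply: functional_extensionality_dep => k;
   apply: code_mdist_eq; rewrite ab0 exprn_gt0.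
Qed.

Let code_mdist_sym a b : code_mdist a b = code_mdist b a.
Proof.
rewrite /code_mdist; congr (limn (series _)); apply/funext => k.
by congr (_ * (~~ _)%:R); apply/asbool_equiv_eq; split.
Qed.

Let code_mdist_triangle b a d :
  code_mdist a d <= code_mdist a b + code_mdist b d.
Proof.
rewrite /code_mdist -limD; [|exact: is_cvg_code_mdist..].
apply: ler_lim; first exact: is_cvg_code_mdist.
  by apply: is_cvgD; exact: is_cvg_code_mdist.
apply: nearW => n; rewrite fctE /series/= -big_split/=; apply: ler_sum => k _.
rewrite -mulrDr ler_wpM2l ?exprn_ge0 ?(ltW c_gt0)//.
rewrite /code_delta -natrD ler_nat.
by do 3 (case: asboolP => //=); move=> -> ->.
Qed.

HB.instance Definition _ := @isMetric.Build R code_space code_mdist code_mdistxx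
  code_mdist_positivity code_mdist_sym code_mdist_triangle.

(* $\alpha(j)$ *)
Definition subcode (j : 'I_m) (a : code_space) : code_space :=
  fun k => (a k.+1) 0 j.

Lemma subcode_mdist j a b :
  c%:num * mdist (subcode j a) (subcode j b) <= mdist a b.
Proof.
rewrite [mdist a b]/(code_mdist a b) [mdist _ _]/(code_mdist _ _).
rewrite mulrC -ler_pdivlMr//; apply: limr_le; first exact: is_cvg_code_mdist.
apply: nearW => n; rewrite ler_pdivlMr// mulrC.
apply: (@le_trans _ _
  (series (fun k => c%:num ^+ k.+1 * code_delta a b k) n.+1)); last first.
  apply: nondecreasing_cvgn_le; last exact: is_cvg_code_mdist.
  by apply: nondecreasing_series => *; exact: term_ge0.
rewrite /series/= big_nat_recl//=.
rewrite -[leLHS]add0r lerD ?term_ge0//.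
rewrite mulr_sumr; apply: ler_sum => k _.
rewrite mulrA -exprS ler_wpM2l ?exprn_ge0 ?(ltW c_gt0)//.
rewrite /code_delta /subcode ler_nat.
by do 2 (case: asboolP => //=); move=> ->.
Qed.

Lemma continuous_subcode j : continuous (subcode j).
Proof.
move=> a; apply/(cvg_ballP (F := nbhs a)) => e e0.
apply: filterS (nbhsx_ballx a _ (mulr_gt0 c_gt0 e0)) => b.
rewrite !ballEmdist/= => ab; rewrite -(ltr_pM2l c_gt0); apply: le_lt_trans ab.
exact: subcode_mdist.
Qed.

Lemma near_code_head a : \forall b \near a, b 0%N = a 0%N.
Proof.
apply: filterS (nbhsx_ballx a _ c_gt0) => b.
rewrite ballEmdist/= => ab; apply: esym; apply: (@code_mdist_eq a b 0%N).
by rewrite expr1.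
Qed.

End code_metric.
Arguments code_space {R} I m c.

Record bcfun (R : realType) (T : topologicalType) (X : metricType R) := Bcfun {
  bcfun_fun :> T -> X;
  bcfun_continuous : continuous bcfun_fun;
  bcfun_bounded : metric_bounded (range bcfun_fun) }.

Section sup_metric.
Context {R : realType} {T : topologicalType} {X : metricType R}.
Local Notation C := (bcfun T X).
Implicit Types f g h : C.

HB.instance Definition _ := gen_eqMixin C.
HB.instance Definition _ := gen_choiceMixin C.

Definition bcfun_mdist f g : R :=
  sup (range (fun t => mdist (f t) (g t))).

Lemma bcfunP f g : (forall t, f t = g t) -> f = g.
Proof.
case: f g => [f fc fb] [g gc gb] /= /funext fg.
by case: _ / fg gc gb => gc gb; congr Bcfun; exact: Prop_irrelevance.
Qed.

Lemma bcfun_mdist_has_ubound f g :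
  has_ubound (range (fun t => mdist (f t) (g t))).
Proof.
have [[t0 _]|T0] := pselect (exists t : T, True); last first.
  by exists 0 => x [t _]; case: T0; exists t.
have [Kf fK] := bcfun_bounded f; have [Kg gK] := bcfun_bounded g.
exists (Kf + (mdist (f t0) (g t0) + Kg)) => _ [t _ <-].
apply: (le_trans (metric_triangle _ (f t0) _)); apply: lerD.
  by apply: fK; [exists t|exists t0].
apply: (le_trans (metric_triangle _ (g t0) _)); apply: lerD => //.
by apply: gK; [exists t0|exists t].
Qed.

Lemma bcfun_mdist_ge f g t : mdist (f t) (g t) <= bcfun_mdist f g.
Proof. by apply: ub_le_sup; [exact: bcfun_mdist_has_ubound|exists t]. Qed.

Lemma bcfun_mdist_le f g (K : R) : 0 <= K ->
  (forall t, mdist (f t) (g t) <= K) -> bcfun_mdist f g <= K.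
Proof.
move=> K0 fgK; rewrite /bcfun_mdist.
have [->|S0] := eqVneq (range (fun t => mdist (f t) (g t))) set0.
  by rewrite sup0.
by apply: ge_sup; [exact/set0P|move=> _ [t _ <-]].
Qed.

Lemma bcfun_mdist_ge0 f g : 0 <= bcfun_mdist f g.
Proof.
rewrite /bcfun_mdist.
have [->|/set0P[_ [t _ _]]] := eqVneq (range (fun t => mdist (f t) (g t))) set0.
  by rewrite sup0.
exact: le_trans (mdist_ge0 _ _) (bcfun_mdist_ge f g t).
Qed.

Let bcfun_mdistxx f : bcfun_mdist f f = 0.
Proof.
apply/eqP; rewrite eq_le bcfun_mdist_ge0 andbT.
by apply: bcfun_mdist_le => // t; rewrite mdistxx.
Qed.

Let bcfun_mdist_positivity f g : bcfun_mdist f g = 0 -> f = g.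
Proof.
move=> fg0; apply: bcfunP => t; apply: mdist_positivity; apply/eqP.
by rewrite eq_le mdist_ge0 andbT -fg0 bcfun_mdist_ge.
Qed.

Let bcfun_mdist_sym f g : bcfun_mdist f g = bcfun_mdist g f.
Proof.
by rewrite /bcfun_mdist; under eq_fun do rewrite metric_sym.
Qed.

Let bcfun_mdist_triangle g f h :
  bcfun_mdist f h <= bcfun_mdist f g + bcfun_mdist g h.
Proof.
apply: bcfun_mdist_le => [|t]; first by rewrite addr_ge0 ?bcfun_mdist_ge0.
by rewrite (le_trans (metric_triangle _ (g t) _))// lerD ?bcfun_mdist_ge.
Qed.

HB.instance Definition _ := @isMetric.Build R C bcfun_mdist bcfun_mdistxx
  bcfun_mdist_positivity bcfun_mdist_sym bcfun_mdist_triangle.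

End sup_metric.

Section operator.
Context {R : realType} {X : metricType R} {I : Type} {m : nat}.
Variables (c : {itv R & `]0, 1[}) (F : gifs X I m).
Local Notation C := (bcfun (code_space I m c) X).
Implicit Types g : 'rV[C]_m.

Definition gifs_operator_fun g (a : code_space I m c) : X :=
  F (a 0%N) (\row_j (g 0 j) (subcode j a)).

Lemma gifs_operator_continuous g : continuous (gifs_operator_fun g).
Proof.
move=> a.
pose x (b : code_space I m c) : 'rV[X]_m := \row_j (g 0 j) (subcode j b).
have x_cvg : x @ a --> x a.
  apply/(cvg_ballP (F := nbhs a)) => d d0.
  near=> b; split=> // i j; rewrite !mxE.
  move: j; near: b; apply: filter_forall => j.
  have gj_cvg : (g 0 j \o subcode j) @ a --> (g 0 j) (subcode j a).
    by apply: continuous_comp; [exact: continuous_subcode|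
                                exact: bcfun_continuous].
  by have /cvg_ballP/(_ _ d0) := gj_cvg.
have Fx_cvg : (F (a 0%N) \o x) @ a --> F (a 0%N) (x a).
  by apply: (@cvg_comp _ _ _ x (F (a 0%N)) (nbhs a) (nbhs (x a)));
    [exact: x_cvg|exact: gifs_continuous].
apply: cvg_trans Fx_cvg; apply: (near_eq_cvg (F := nbhs a)).
apply: filterS (near_code_head a) => b ba.
by rewrite /gifs_operator_fun/= ba.
Unshelve. all: by end_near. Qed.

Lemma gifs_operator_bounded g : metric_bounded (range (gifs_operator_fun g)).
Proof.
pose B : set 'rV[X]_m := [set x | forall j, range (g 0 j) (x 0 j)].
have B_bounded : metric_bounded B.
  have /choice[K gK] := fun j => bcfun_bounded (g 0 j).
  exists (\big[Num.max/0]_(j < m) K j) => x y Bx By.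
  by apply: le_bigmax2 => j _; exact: gK.
have [K FK] := gifs_bounded F B_bounded.
exists K => _ _ [a _ <-] [b _ <-].
have H (b' : code_space I m c) : (\bigcup_(i in [set: I]) (F i @` B))
    (gifs_operator_fun g b').
  exists (b' 0%N) => //; exists (\row_j (g 0 j) (subcode j b')) => // j.
  by rewrite mxE; exists (subcode j b').
by apply: FK; exact: H.
Qed.

Definition gifs_operator g : C :=
  Bcfun (@gifs_operator_continuous g) (@gifs_operator_bounded g).

End operator.
Arguments gifs_operator {R X I m} c F g.

(* Main.v *)
Require Import Defs.
From mathcomp Require Import all_boot all_order all_algebra.
From mathcomp Require Import all_classical all_reals all_analysis.
Import Order.TTheory GRing.Theory Num.Theory.
Local Open Scope classical_set_scope.
Local Open Scope ring_scope.

(** Evaluating [gifs_operator c F g] at a code [a] applies the function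
    indexed by the head of [a] to the row of values [(g 0 j) (subcode j a)].
    Two rows [g], [h] at distance less than [delta] yield, at every [a], points
    of $X^m$ at distance less than [delta] ([mdist_eval_subcode_le]).  The head
    of [a] ranges over all indices, so one modulus of continuity has to serve
    the whole family: this is uniform equicontinuity, and it bounds the pointwise
    distance of the images uniformly in [a].  Taking the supremum over [a] gives
    the uniform continuity of the operator
    ([gifs_operator_uniformly_continuous]), hence its continuity. *)

Lemma mdist_eval_subcode_le (R : realType) (X : metricType R) (I : Type)
    (m : nat) (c : {itv R & `]0, 1[})
    (g h : 'rV[bcfun (code_space I m c) X]_m) (a : code_space I m c) :
  mdist (\row_j (g 0 j) (subcode j a)) (\row_j (h 0 j) (subcode j a)) <=
  mdist g h.
Proof.
by apply: le_bigmax2 => j _; rewrite !mxE; exact: bcfun_mdist_ge.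
Qed.

Lemma gifs_operator_uniformly_continuous (R : realType) (X : metricType R)
    (I : Type) (m : nat) (c : {itv R & `]0, 1[}) (F : gifs X I m) :
  uniformly_equicontinuous F ->
  forall eps : R, 0 < eps -> exists2 delta : R, 0 < delta &
    forall g h : 'rV[bcfun (code_space I m c) X]_m, mdist g h < delta ->
      mdist (gifs_operator c F g) (gifs_operator c F h) < eps.
Proof.
move=> F_equi eps eps0.
(* A supremum of distances below [eps] may equal [eps]; halving keeps the final
   bound strict. *)
have eps20 : 0 < eps / 2 by rewrite divr_gt0.
have [delta delta0 Fdelta] := F_equi _ eps20.
exists delta => // g h gh.
apply: (@le_lt_trans _ _ (eps / 2)); last first.
  by rewrite ltr_pdivrMr// ltr_pMr// ltr1n.
apply: bcfun_mdist_le => [|a]; first exact: ltW.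
by apply/ltW/Fdelta/(le_lt_trans _ gh)/mdist_eval_subcode_le.
Qed.

Theorem proposition3p1 (R : realType) (X : metricType R) (I : Type) (m : nat)
    (c : {itv R & `]0, 1[}) (F : gifs X I m)
    (X_nonempty : [set: X] !=set0) (I_nonempty : [set: I] !=set0)
    (m_gt0 : (0 < m)%N)
    (F_equicontinuous : uniformly_equicontinuous F) :
  continuous (gifs_operator c F :
    'rV[bcfun (code_space I m c) X]_m -> bcfun (code_space I m c) X).
Proof.
move=> g; apply/(cvg_ballP (F := nbhs g)) => eps eps0.
have [delta delta0 H_delta] :=
  gifs_operator_uniformly_continuous _ _ _ _ c _ F_equicontinuous _ eps0.
apply: filterS (nbhsx_ballx g _ delta0) => h.
by rewrite !ballEmdist/=; exact: H_delta.
Qed.
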